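(* Let $(W,g)$ be a Riemannian manifold and let $f$ be a homothety of its Riemannian cone $\mathcal C(W)$ with dilation factor $\rho_f$. Suppose moreover that $f$ commutes with the radial flow $\phi_s$ given by $\phi_s(w,t)=(w,s\cdot t)$, $s>0$. Then $f(w,t)=(\psi_f(w),\rho_f\cdot t)$, where $\psi_f$ is an isometry of $W$. In particular, the isometries of $W$ are the isometries of the cone $\mathcal C(W)$ commuting with the radial flow $\phi_s$ (the isometry $\psi$ of $W$ corresponding to $\psi\times\mathrm{Id}$).
   Context: The Riemannian cone of $(W,g)$ is $\mathcal C(W)=W\times\mathbb{R}^+$ with metric $\tilde g=dt^2+t^2g$. A homothety of $\mathcal C(W)$ with dilation factor $\rho_f>0$ is a diffeomorphism $f$ with $f^*\tilde g=\rho_f^2\,\tilde g$. *)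

(* Defs.v *)
From mathcomp Require Import all_boot all_order all_algebra.
From mathcomp Require Import all_classical all_reals all_analysis.

Set Implicit Arguments.
Unset Strict Implicit.
Unset Printing Implicit Defensive.

Import Order.TTheory GRing.Theory Num.Theory.
Import numFieldNormedType.Exports.

Local Open Scope classical_set_scope.
Local Open Scope ring_scope.

(* C^k maps on an open set U, by iterated directional derivatives. For a
   finite-dimensional V (the only case used) this is the usual notion. *)
Fixpoint Ck_on (R : realType) (V E : normedModType R) (k : nat) (U : set V)
    (f : V -> E) {struct k} : Prop :=
  match k with
  | 0 => forall x, U x -> {for x, continuous f}
  | k'.+1 => (forall x, U x -> differentiable f x) /\
             (forall v, Ck_on k' U ('D_v f))
  end.

Definition smooth_on (R : realType) (V E : normedModType R) (U : set V)
  (f : V -> E) : Prop := forall k, Ck_on k U f.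

Section Calculus.
Context {R : realType}.
Implicit Types V E F : normedModType R.

Lemma near_eq_differentiable V E (f g : V -> E) (x : V) :
  {near x, f =1 g} -> differentiable f x -> differentiable g x.
Proof.
move=> fg df.
suff [c e] : continuous ('d f x) /\
    g \o shift x = cst (g x) + 'd f x +o_ 0 id.
  by apply/diff_locallyP; rewrite (diff_unique c e).
split; first exact: diff_continuous.
have /eqaddoP h := diff_locally df.
apply/eqaddoP => e e0; have := h e e0.
have fg0 : \forall y \near (0 : V), f (y + x) = g (y + x).
  have c : (y + x) @[y --> (0 : V)] --> x.
    by rewrite -[X in _ --> X]add0r; apply: cvgD; [exact: cvg_id|exact: cvg_cst].
  exact: c fg.
rewrite -(nbhs_singleton fg) => h1.
apply: filterS2 fg0 h1 => y ey. by rewrite !fctE /= /shift/= ey.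
Qed.

Lemma Ck_on_congr V E k (U : set V) (f g : V -> E) : open U ->
  (forall x, U x -> f x = g x) -> Ck_on k U f -> Ck_on k U g.
Proof.
move=> oU; elim: k f g => [|k IH] f g fg /=.
  move=> fc x Ux.
  have nfg : {near x, f =1 g}.
    by apply: filterS (open_nbhs_nbhs (conj oU Ux)) => y Uy; exact: fg.
  by apply: cvg_trans (near_eq_cvg nfg) _; rewrite -(fg x Ux); exact: fc.
have nfg x : U x -> {near x, f =1 g}.
  by move=> Ux; apply: filterS (open_nbhs_nbhs (conj oU Ux)) => y Uy; exact: fg.
move=> [df dk]; split => [x Ux|v].
  exact: near_eq_differentiable (nfg x Ux) (df x Ux).
apply: IH (dk v) => x Ux; apply: near_eq_derive; exact: nfg.
Qed.

Lemma Ck_on_sub V E k (U U' : set V) (f : V -> E) :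
  U' `<=` U -> Ck_on k U f -> Ck_on k U' f.
Proof.
move=> sU; elim: k f => [|k IH] f /=; first by move=> fc x /sU; exact: fc.
by move=> [df dk]; split => [x /sU|v]; [exact: df|exact: IH].
Qed.

Lemma Ck_on_cst V E k (U : set V) (c : E) : Ck_on k U (fun=> c).
Proof.
elim: k c => [|k IH] c /=; first by move=> x _; exact: cst_continuous.
split => [x _|v]; first exact: differentiable_cst.
rewrite (_ : 'D_v _ = fun=> 0); first exact: IH.
by apply/funext => x; exact: derive_cst.
Qed.

Lemma Ck_on_linear V E k (U : set V) (f : {linear V -> E}) :
  continuous f -> Ck_on k U f.
Proof.
case: k => [|k] fc /=; first by move=> x _; exact: fc.
split => [x _|v]; first exact: linear_differentiable.
rewrite (_ : 'D_v f = fun=> f v); first exact: Ck_on_cst.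
apply/funext => x.
by rewrite deriveE; [rewrite diff_lin|exact: linear_differentiable].
Qed.

Lemma Ck_on_le V E k (U : set V) (f : V -> E) : Ck_on k.+1 U f -> Ck_on k U f.
Proof.
elim: k f => [|k IH] f [df dk].
  by move=> x /df; exact: differentiable_continuous.
by split => // v; exact: IH.
Qed.

Lemma Ck_on_pair V E F k (U : set V) (f : V -> E) (g : V -> F) : open U ->
  Ck_on k U f -> Ck_on k U g -> Ck_on k U (fun x => (f x, g x)).
Proof.
move=> oU; elim: k f g => [|k IH] f g /=.
  by move=> fc gc x Ux; apply: cvg_pair; [exact: fc|exact: gc].
move=> [df dkf] [dg dkg]; split => [x Ux|v].
  by apply: differentiable_pair; [exact: df|exact: dg].
apply: (Ck_on_congr (f := fun x => ('D_v f x, 'D_v g x))) => //.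
  move=> x Ux; rewrite !deriveE; [by rewrite diff_pair//; [exact: df|exact: dg]|..].
  - by apply: differentiable_pair; [exact: df|exact: dg].
  - exact: dg.
  - exact: df.
exact: IH.
Qed.

Lemma Ck_on_compl V E F k (U : set V) (l : {linear F -> V}) (f : V -> E) :
  open U -> continuous l ->
  Ck_on k U f -> Ck_on k (l @^-1` U) (f \o l).
Proof.
move=> oU lc; elim: k f => [|k IH] f /=.
  by move=> fc x Ux; apply: continuous_comp; [exact: lc|exact: fc].
have dl x : differentiable l x by exact: linear_differentiable.
move=> [df dk]; split => [x Ux|v].
  by apply: differentiable_comp => //; exact: df.
apply: (Ck_on_congr (f := 'D_(l v) f \o l)) (IH _ (dk _)).
  by apply: open_comp => // ? _; exact: lc.
move=> x Ux /=; have dfx := df _ Ux.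
rewrite !deriveE//; last exact: differentiable_comp.
by rewrite [in RHS]diff_comp//= diff_lin.
Qed.

Lemma Ck_on_add V E k (U : set V) (f g : V -> E) : open U ->
  Ck_on k U f -> Ck_on k U g -> Ck_on k U (fun x => f x + g x).
Proof.
move=> oU; elim: k f g => [|k IH] f g /=.
  by move=> fc gc x Ux; exact: (continuousD (fc x Ux) (gc x Ux)).
move=> [df dkf] [dg dkg]; split => [x Ux|v].
  exact: (differentiableD (df x Ux) (dg x Ux)).
apply: (Ck_on_congr (f := fun x => 'D_v f x + 'D_v g x)) => //.
  move=> x Ux; exact/esym/(deriveD (diff_derivable (df x Ux)) (diff_derivable (dg x Ux))).
exact: IH.
Qed.

Lemma Ck_on_mul V k (U : set V) (f g : V -> R) : open U ->
  Ck_on k U f -> Ck_on k U g -> Ck_on k U (fun x => f x * g x).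
Proof.
move=> oU; elim: k f g => [|k IH] f g.
  by move=> /= fc gc x Ux; exact: (continuousM (fc x Ux) (gc x Ux)).
move=> kf kg; have kf' := Ck_on_le kf; have kg' := Ck_on_le kg.
move: kf kg => [df dkf] [dg dkg]; split => [x Ux|v].
  exact: (differentiableM (df x Ux) (dg x Ux)).
apply: (Ck_on_congr (f := fun x => f x * 'D_v g x + g x * 'D_v f x)) => //.
  move=> x Ux; exact/esym/(deriveM (diff_derivable (df x Ux)) (diff_derivable (dg x Ux))).
exact: Ck_on_add oU (IH _ _ kf' (dkg v)) (IH _ _ kg' (dkf v)).
Qed.

Lemma smooth_on_differentiable V E (U : set V) (f : V -> E) x :
  smooth_on U f -> U x -> differentiable f x.
Proof. by move=> /(_ 1%N)[+ _] Ux; exact. Qed.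

End Calculus.

Record chart (R : realType) (E : normedModType R) (M : topologicalType) := Chart {
  source : set M;
  target : set E;
  chart_map :> M -> E;
  param : E -> M;
  source_open : open source;
  target_open : open target;
  chart_map_target : forall p, source p -> target (chart_map p);
  param_source : forall x, target x -> source (param x);
  chart_mapK : forall p, source p -> param (chart_map p) = p;
  paramK : forall x, target x -> chart_map (param x) = x;
  chart_map_continuous : forall p, source p -> {for p, continuous chart_map};
  param_continuous : forall x, target x -> {for x, continuous param} }.

(* Smooth manifold without boundary modelled on E; the atlas need not be maximal.
   Every point comes with a preferred chart [chart_at p]; the tangent space at p
   is identified with E by reading tangent vectors in that chart. *)
Record manifold (R : realType) (E : normedModType R) := Manifold {
  carrier :> topologicalType;
  atlas : set (chart E carrier);
  chart_at : carrier -> chart E carrier;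
  manifold_hausdorff : hausdorff_space carrier;
  manifold_second_countable : @second_countable carrier;
  chart_at_atlas : forall p, atlas (chart_at p);
  chart_at_source : forall p, source (chart_at p) p;
  transition_smooth : forall c d, atlas c -> atlas d ->
    smooth_on (target c `&` param c @^-1` source d) (d \o param c) }.

Definition smooth (R : realType) (E F : normedModType R)
    (M : manifold E) (N : manifold F) (f : M -> N) : Prop :=
  continuous f /\
  forall (c : chart E M) (d : chart F N), atlas c -> atlas d ->
    smooth_on (target c `&` (f \o param c) @^-1` source d) (d \o f \o param c).

Definition diffeomorphism (R : realType) (E F : normedModType R)
    (M : manifold E) (N : manifold F) (f : M -> N) : Prop :=
  smooth f /\ exists g : N -> M, [/\ smooth g, cancel f g & cancel g f].

Definition tangent_map (R : realType) (E F : normedModType R)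
    (M : manifold E) (N : manifold F) (f : M -> N) (p : M) : E -> F :=
  'd (chart_at (f p) \o f \o param (chart_at p)) (chart_at p p).

(* [metric p] is the inner product on T_pM = E; in a chart c, a vector u at x is
   carried to the preferred chart at [param c x] by the derivative of the
   transition map. *)
Record riemannian_manifold (R : realType) (E : normedModType R) :=
    RiemannianManifold {
  base :> manifold E;
  metric : base -> E -> E -> R;
  metric_sym : forall p u v, metric p u v = metric p v u;
  metric_linear : forall p a u u' v,
    metric p (a *: u + u') v = a * metric p u v + metric p u' v;
  metric_gt0 : forall p u, u != 0 -> 0 < metric p u u;
  metric_smooth : forall c : chart E base, atlas c -> forall u v,
    smooth_on (target c) (fun x =>
      metric (param c x) ('d (chart_at (param c x) \o param c) x u)
                         ('d (chart_at (param c x) \o param c) x v)) }.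

Section Isometries.
Context {R : realType} {E : normedModType R}.
Variable M : riemannian_manifold E.

Definition pullback_metric (f : M -> M) (p : M) (u v : E) : R :=
  metric (f p) (tangent_map f p u) (tangent_map f p v).

Definition riemannian_isometry (f : M -> M) : Prop :=
  diffeomorphism f /\
  forall p u v, pullback_metric f p u v = metric p u v.

End Isometries.

Lemma fst_continuous (S T : topologicalType) : continuous (@fst S T).
Proof. by move=> x; exact: cvg_fst. Qed.

Lemma snd_continuous (S T : topologicalType) : continuous (@snd S T).
Proof. by move=> x; exact: cvg_snd. Qed.

Lemma chart_overlap_open (R : realType) (E : normedModType R)
    (M : topologicalType) (c d : chart E M) :
  open (target c `&` param c @^-1` source d).
Proof.
have /(continuous_inP _ (target_open c)) h : {in target c, continuous (param c)}.
  by move=> x /set_mem; exact: param_continuous.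
exact: h (source_open d).
Qed.

Definition positive_reals (R : realType) : set R := [set t | 0 < t].
Arguments positive_reals R : clear implicits.

Section PositiveReals.
Context {R : realType}.
Implicit Types s t : positive_reals R.

Lemma pos_gt0 t : 0 < \val t.
Proof. exact: set_mem (valP t). Qed.

Definition mkpos (x : R) (x0 : 0 < x) : positive_reals R :=
  SigSub (mem_set (x0 : positive_reals R x)).

Definition pos_mul s t : positive_reals R := mkpos (mulr_gt0 (pos_gt0 s) (pos_gt0 t)).

(* A total left inverse of \val, with junk value 1 on nonpositive reals. *)
Definition to_pos (x : R) : positive_reals R := insubd (mkpos ltr01) x.

Lemma val_to_pos (x : R) : 0 < x -> \val (to_pos x) = x.
Proof. by move=> x0; apply: insubdK; exact: mem_set. Qed.

Lemma to_posK t : to_pos (\val t) = t.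
Proof. exact: valKd. Qed.

Lemma positive_reals_open : open (positive_reals R).
Proof. exact: open_gt. Qed.

Lemma val_pos_continuous : continuous (\val : positive_reals R -> R).
Proof. exact: initial_continuous. Qed.

Lemma to_pos_continuous (x : R) : 0 < x -> {for x, continuous to_pos}.
Proof.
move=> x0; apply/cvg_ballP => e e0.
have x0' : \forall y \near x, 0 < y.
  exact: open_nbhs_nbhs (conj positive_reals_open x0).
have xe : \forall y \near x, ball x e y by exact: nbhsx_ballx.
apply: filterS2 x0' xe => y y0 xey.
rewrite -initial_ballE /=.
by have := xey; rewrite -[in X in X -> _](val_to_pos x0) -[in X in X -> _](val_to_pos y0).
Qed.

End PositiveReals.

Lemma cluster_continuous (S T : topologicalType) (f : S -> T) (p q : S) :
  continuous f -> cluster (nbhs p) q -> cluster (nbhs (f p)) (f q).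
Proof.
move=> fc pq A B /fc fA /fc fB.
by have [z [Az Bz]] := pq _ _ fA fB; exists (f z).
Qed.

Lemma hausdorff_pos (R : realType) : hausdorff_space (positive_reals R).
Proof.
move=> p q /(cluster_continuous val_pos_continuous) /Rhausdorff.
exact: val_inj.
Qed.

Lemma hausdorff_prod (S T : topologicalType) :
  hausdorff_space S -> hausdorff_space T -> hausdorff_space (S * T)%type.
Proof.
move=> hS hT [p s] [q t] h; congr (_, _).
  by apply: hS; apply: (cluster_continuous (f := fst)) h => x; exact: cvg_fst.
by apply: hT; apply: (cluster_continuous (f := snd)) h => x; exact: cvg_snd.
Qed.

Lemma open_prod (S T : topologicalType) (A : set S) (B : set T) :
  open A -> open B -> open (A `*` B).
Proof.
rewrite !openE => oA oB [p q] [/= Ap Bq].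
by exists (A, B) => //; split; [exact: oA|exact: oB].
Qed.

Lemma second_countable_prod (S T : topologicalType) :
  @second_countable S -> @second_countable T -> @second_countable (S * T)%type.
Proof.
move=> [A cA [oA bA]] [B cB [oB bB]].
exists ((fun X => X.1 `*` X.2) @` (A `*` B)).
  by apply: sub_countable (card_image_le _ _) _; exact: countableX.
split.
  by move=> _ [[X Y] /= [AX BY] <-]; apply: open_prod; [exact: oA|exact: oB].
move=> [p q] V [[X Y] /= [nX nY] XYV].
have [X' [AX' X'p] X'X] := bA p X nX.
have [Y' [BY' Y'q] Y'Y] := bB q Y nY.
exists (X' `*` Y').
  by split => //; exists (X', Y').
by move=> [a b] [/= Xa Yb]; apply: XYV; split; [exact: X'X|exact: Y'Y].
Qed.

Lemma second_countable_pos (R : realType) :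
  @second_countable (positive_reals R).
Proof.
pose I (pq : rat * rat) : set (positive_reals R) :=
  [set t | ratr pq.1 < \val t < ratr pq.2].
exists (range I).
  exact: sub_countable (card_image_le _ _) (countableP _).
split.
  move=> _ [[p q] _ <-].
  have -> : I (p, q) = \val @^-1` `](ratr p : R), ratr q[%classic.
    by apply/seteqP; split => t; rewrite /I/= in_itv.
  have /continuousP := @val_pos_continuous R; apply.
  exact: itv_open.
move=> t V /nbhs_ballP[e /= e0 eV].
have [p] := @rat_in_itvoo R (\val t - e) (\val t) ltac:(by rewrite ltrBlDr ltrDl).
rewrite in_itv/= => /andP[p1 p2].
have [q] := @rat_in_itvoo R (\val t) (\val t + e) ltac:(by rewrite ltrDl).
rewrite in_itv/= => /andP[q1 q2].
exists (I (p, q)); first by split; [exists (p, q)|rewrite /I/= p2 q1].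
move=> u /andP[/= pu uq]; apply: eV; rewrite -initial_ballE/= /ball/=.
by rewrite distrC ltr_distl (lt_trans p1 pu) (lt_trans uq q2).
Qed.

Definition homothety (R : realType) (E : normedModType R)
    (M : riemannian_manifold E) (rho : positive_reals R) (f : M -> M) : Prop :=
  diffeomorphism f /\
  forall p u v, pullback_metric f p u v = (\val rho) ^+ 2 * metric p u v.

(* W x (0, +oo), with the product topology and the product charts. It is modelled
   on E * R; for E = 'rV_n this stands for R^(n+1). *)
Section ConeManifold.
Context {R : realType} {E : normedModType R}.

Section Chart.
Variables (M : topologicalType) (c : chart E M).

Let src : set (M * positive_reals R) := source c `*` setT.
Let tgt : set (E * R) := target c `*` positive_reals R.
Let crd (p : M * positive_reals R) : E * R := (c p.1, \val p.2).
Let prm (x : E * R) : M * positive_reals R := (param c x.1, to_pos x.2).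

Fact cone_source_open : open src.
Proof. by apply: open_prod; [exact: source_open|exact: openT]. Qed.

Fact cone_target_open : open tgt.
Proof. by apply: open_prod; [exact: target_open|exact: positive_reals_open]. Qed.

Fact cone_chart_map_target p : src p -> tgt (crd p).
Proof. by move=> [cp _]; split; [exact: chart_map_target|exact: pos_gt0]. Qed.

Fact cone_param_source x : tgt x -> src (prm x).
Proof. by move=> [cx _]; split => //; exact: param_source. Qed.

Fact cone_chart_mapK p : src p -> prm (crd p) = p.
Proof.
by case: p => w t [/= cw _]; rewrite /prm/= chart_mapK// to_posK.
Qed.

Fact cone_paramK x : tgt x -> crd (prm x) = x.
Proof. by case: x => y s [/= cy s0]; rewrite /crd/= paramK// val_to_pos. Qed.

Fact cone_chart_map_continuous p : src p -> {for p, continuous crd}.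
Proof.
move=> [cp _].
have h1 : {for p, continuous (c \o fst)}.
  exact: (@continuous_comp _ _ _ fst _ p cvg_fst (chart_map_continuous cp)).
have h2 : {for p, continuous (\val \o snd : M * positive_reals R -> R)}.
  exact: (@continuous_comp _ _ _ snd _ p cvg_snd (@val_pos_continuous R p.2)).
exact: (cvg_pair h1 h2).
Qed.

Fact cone_param_continuous x : tgt x -> {for x, continuous prm}.
Proof.
move=> [cx x0].
have h1 : {for x, continuous (param c \o fst)}.
  exact: (@continuous_comp _ _ _ fst _ x cvg_fst (param_continuous cx)).
have h2 : {for x, continuous (@to_pos R \o snd)}.
  exact: (@continuous_comp _ _ _ snd _ x cvg_snd (to_pos_continuous x0)).
exact: (cvg_pair h1 h2).
Qed.

Definition cone_chart : chart (E * R)%type (M * positive_reals R)%type :=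
  Chart cone_source_open cone_target_open cone_chart_map_target cone_param_source
    cone_chart_mapK cone_paramK cone_chart_map_continuous cone_param_continuous.

End Chart.

Lemma cone_transitionE (M : topologicalType) (c d : chart E M) (x : E * R) :
  target (cone_chart c) x ->
  (cone_chart d \o param (cone_chart c)) x = ((d \o param c) x.1, x.2).
Proof. by case: x => y s [/= _ s0]; rewrite val_to_pos. Qed.

Variable W : manifold E.

Definition cone_atlas : set (chart (E * R)%type (W * positive_reals R)%type) :=
  (@cone_chart W) @` (atlas (m := W)).

Definition cone_chart_at (p : W * positive_reals R) := cone_chart (chart_at p.1).

Fact cone_chart_at_atlas p : cone_atlas (cone_chart_at p).
Proof. by exists (chart_at p.1) => //; exact: chart_at_atlas. Qed.

Fact cone_chart_at_source p : source (cone_chart_at p) p.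
Proof. by split => //; exact: chart_at_source. Qed.

Fact cone_transition_smooth c d : cone_atlas c -> cone_atlas d ->
  smooth_on (target c `&` param c @^-1` source d) (d \o param c).
Proof.
move=> [{}c ac <-] [{}d ad <-] k.
have oU := chart_overlap_open (cone_chart c) (cone_chart d).
apply: (Ck_on_congr (f := fun x => ((d \o param c) x.1, x.2)) oU).
  by move=> x [cx _]; rewrite cone_transitionE.
apply: Ck_on_pair => //.
  have h := Ck_on_compl (l := fst : {linear (E * R)%type -> E})
    (chart_overlap_open c d) (@fst_continuous E R) (transition_smooth ac ad k).
  by apply: Ck_on_sub _ h => -[y s] [[/= ty s0] [/= sy _]].
exact: Ck_on_linear (@snd_continuous E R).
Qed.

Definition cone_manifold : manifold (E * R)%type :=
  Manifold
    (hausdorff_prod (@manifold_hausdorff _ _ W) (@hausdorff_pos R))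
    (second_countable_prod (@manifold_second_countable _ _ W)
      (@second_countable_pos R))
    cone_chart_at_atlas cone_chart_at_source cone_transition_smooth.

End ConeManifold.

Section Cone.
Context {R : realType} {E : normedModType R}.
Variable W : riemannian_manifold E.

(* dt^2 + t^2 g *)
Definition cone_metric (p : cone_manifold W) (u v : E * R) : R :=
  u.2 * v.2 + (\val p.2) ^+ 2 * metric p.1 u.1 v.1.

Fact cone_metric_sym p u v : cone_metric p u v = cone_metric p v u.
Proof. by rewrite /cone_metric metric_sym mulrC. Qed.

Fact cone_metric_linear p a u u' v :
  cone_metric p (a *: u + u') v = a * cone_metric p u v + cone_metric p u' v.
Proof.
rewrite /cone_metric /= metric_linear /GRing.scale /=.
rewrite mulrDl !mulrDr -!addrA; congr (_ + _); first by rewrite mulrA.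
by rewrite addrCA; congr (_ + _); rewrite mulrCA.
Qed.

Fact cone_metric_gt0 p u : u != 0 -> 0 < cone_metric p u u.
Proof.
case: u => u a ua0; rewrite /cone_metric/= -expr2.
have p0 : 0 < (\val p.2) ^+ 2 by rewrite exprn_gt0// pos_gt0.
have [u0|u0] := eqVneq u 0; last first.
  by rewrite ltr_wpDl ?sqr_ge0// mulr_gt0// metric_gt0.
have a0 : a != 0 by apply: contra_neq ua0 => ->; rewrite u0.
have m0 : metric p.1 u u = 0.
  have := metric_linear (r := W) p.1 (-1) 0 0 0.
  by rewrite u0 scaler0 addr0 mulN1r addNr.
by rewrite m0 mulr0 addr0 exprn_even_gt0.
Qed.

Fact cone_metric_smooth (c : chart (E * R)%type (cone_manifold W)) :
  atlas c -> forall u v, smooth_on (target c) (fun x =>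
    cone_metric (param c x)
      ('d (chart_at (param c x) \o param c) x u)
      ('d (chart_at (param c x) \o param c) x v)).
Proof.
move=> [{}c ac <-] [u a] [v b] k.
pose G y := metric (param c y) ('d (chart_at (param c y) \o param c) y u)
                               ('d (chart_at (param c y) \o param c) y v).
have oU := target_open (cone_chart c).
have dE (x : E * R) w e : target (cone_chart c) x ->
    'd (chart_at (param (cone_chart c) x : cone_manifold W)
          \o param (cone_chart c)) x (w, e) =
    ('d (chart_at (param c x.1) \o param c) (x.1) w, e).
  move=> tx; set d := chart_at (param c x.1).
  pose T y : E * R := ((d \o param c \o fst) y, y.2).
  have ad : atlas d by exact: chart_at_atlas.
  have dx : differentiable (d \o param c) x.1.
    apply: (smooth_on_differentiable (transition_smooth ac ad)).
    by case: tx => tx _; split => //; exact: chart_at_source.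
  have dfst : differentiable (fst : E * R -> E) x.
    exact: linear_differentiable (@fst_continuous E R).
  have dsnd : differentiable (snd : E * R -> R) x.
    exact: linear_differentiable (@snd_continuous E R).
  have dT1 : differentiable ((d \o param c) \o fst) x.
    exact: differentiable_comp.
  have dT : differentiable T x by exact: differentiable_pair.
  have nT : {near x, T =1 cone_chart d \o param (cone_chart c)}.
    by apply: filterS (open_nbhs_nbhs (conj oU tx)) => y ty;
      rewrite cone_transitionE.
  rewrite -deriveE; last exact: near_eq_differentiable nT dT.
  rewrite -(near_eq_derive _ nT) deriveE// diff_pair//.
  have -> : 'd (snd : E * R -> R) x = snd :> (_ -> _).
    exact: (@diff_lin R (E * R)%type R snd x (@snd_continuous E R)).
  have efst : 'd (fst : E * R -> E) x = fst :> (_ -> _).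
    exact: (@diff_lin R (E * R)%type E fst x (@fst_continuous E R)).
  by rewrite diff_comp//= efst.
apply: (Ck_on_congr (f := fun x : E * R => a * b + x.2 * x.2 * G x.1)) => //.
  move=> x tx; rewrite !dE// /cone_metric/= expr2.
  by case: tx => _ x0; rewrite val_to_pos.
have cfst := @fst_continuous E R.
have csnd := @snd_continuous E R.
have ksnd : Ck_on k (target (cone_chart c)) (snd : E * R -> R).
  exact: Ck_on_linear.
have kG : Ck_on k (target (cone_chart c)) (G \o (fst : {linear (E * R)%type -> E})).
  have := Ck_on_compl (l := fst : {linear (E * R)%type -> E}) (target_open c) cfst
    (metric_smooth ac u v k).
  by apply: Ck_on_sub => x [].
apply: Ck_on_add => //; first exact: Ck_on_cst.
exact: (Ck_on_mul oU (Ck_on_mul oU ksnd ksnd) kG).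
Qed.

Definition cone : riemannian_manifold (E * R)%type :=
  RiemannianManifold cone_metric_sym cone_metric_linear cone_metric_gt0
    cone_metric_smooth.

Definition radial_flow (s : positive_reals R) (p : cone) : cone :=
  (p.1, pos_mul s p.2).

Definition commutes_with_radial_flow (f : cone -> cone) : Prop :=
  forall s p, f (radial_flow s p) = radial_flow s (f p).

Definition prod_id (psi : W -> W) (p : cone) : cone := (psi p.1, p.2).

End Cone.

(* Main.v *)
Require Import Defs.
From mathcomp Require Import all_boot all_order all_algebra.
From mathcomp Require Import all_classical all_reals all_analysis.

Import Order.TTheory GRing.Theory Num.Theory.
Import numFieldNormedType.Exports.

Local Open Scope classical_set_scope.
Local Open Scope ring_scope.

(** A map [f] commuting with the radial flow is determined by its values at height 1:
    [f (w, t) = (psi w, t * b w)] with [psi = cone_slice f]. It therefore sends the unit radial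
    vector at [(w, 1)] to the radial vector of length [b w], and the homothety condition forces
    [b w = rho] for every [w]. So [f] is the product [cone_map rho psi]
    ([homothety_commutes_cone_map]).

    The differential of such a product is block diagonal, [psi]'s differential plus multiplication
    by [rho], so the cone metric pulls back to rho^2 (dt^2 + t^2 psi^*g) ([pullback_cone_map]). This
    is rho^2 times the cone metric exactly when psi^*g = g. Together with the transfer of smoothness
    and inverses between [psi] and the product, this gives the equivalence [homothety_cone_map].
    Both claims follow, the second by taking [rho] equal to 1. *)

(** * Calculus of C^k maps: slices and linear images *)

Section CkComposition.
Context {R : realType} {V E F : normedModType R}.

Lemma is_diff_slice (e : F) (x : V) :
  is_diff x (fun y : V => (y, e)) (fun v => (v, 0)).
Proof.
exact: is_diff_pair (is_diff_id x) (is_diff_cst e x).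
Qed.

(** The derivative of the slice along [v] is the slice of the derivative of [f] along [(v, 0)], so
    induction on [k] applies. *)
Lemma Ck_on_slice {k} {U : set (V * F)} {f : V * F -> E} (e : F) : open U ->
  Ck_on k U f -> Ck_on k [set x | U (x, e)] (fun x => f (x, e)).
Proof.
move=> oU; have ic : continuous (fun y : V => (y, e)).
  by move=> y; have [+ _] := is_diff_slice e y; exact: differentiable_continuous.
elim: k f => [|k IH] f /=.
  by move=> fc x Ux; apply: (continuous_comp (f := fun y => (y, e)) (ic x)); exact: fc.
move=> [df dk]; split => [x Ux|v].
  apply: (@differentiable_comp R V _ E (fun y => (y, e)) f) (df _ Ux).
  by have [] := is_diff_slice e x.
apply: (Ck_on_congr (f := fun x => 'D_((v, 0) : V * F) f (x, e))) (IH _ (dk _)).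
  exact: (open_comp (f := fun y => (y, e))).
move=> x Ux; have dfx := df _ Ux; have [di ei] := is_diff_slice e x.
rewrite !deriveE//; last exact: (@differentiable_comp R V _ E (fun y => (y, e)) f).
by rewrite (@diff_comp R V _ E (fun y => (y, e)) f)//= ei.
Qed.

Lemma Ck_on_linear_comp {k} {U : set V} (l : {linear E -> F}) {f : V -> E} :
  open U -> continuous l -> Ck_on k U f -> Ck_on k U (l \o f).
Proof.
move=> oU lc; elim: k f => [|k IH] f /=.
  by move=> fc x Ux; apply: continuous_comp; [exact: fc|exact: lc].
have dl x : differentiable l x by exact: linear_differentiable.
move=> [df dk]; split => [x Ux|v].
  by apply: differentiable_comp => //; exact: df.
apply: (Ck_on_congr (f := l \o 'D_v f)) (IH _ (dk _)) => // x Ux /=.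
have dfx := df _ Ux.
rewrite !deriveE//; last exact: differentiable_comp.
by rewrite [in RHS]diff_comp//= diff_lin.
Qed.

End CkComposition.

Section Charts.
Context {R : realType} {E F : normedModType R}.

Lemma chart_preimage_open {M N : topologicalType} (f : M -> N)
    (c : chart E M) (d : chart F N) : continuous f ->
  open (target c `&` (f \o param c) @^-1` source d).
Proof.
move=> fc.
have /(continuous_inP _ (target_open c)) h :
    {in target c, continuous (f \o param c)}.
  move=> x /set_mem tx; apply: continuous_comp; last exact: fc.
  exact: param_continuous.
exact: h (source_open d).
Qed.

(** [tangent_map] is defined through ['d], which is a true derivative only where the map is
    differentiable; this supplies that condition. *)
Lemma tangent_map_differentiable {M : manifold E} {N : manifold F} (f : M -> N) p :
  smooth f ->
  differentiable (chart_at (f p) \o f \o param (chart_at p)) (chart_at p p).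
Proof.
move=> [_ fs].
apply: smooth_on_differentiable (fs _ _ (chart_at_atlas p) (chart_at_atlas (f p))) _.
split; first by apply: chart_map_target; exact: chart_at_source.
rewrite /= chart_mapK; exact: chart_at_source.
Qed.

End Charts.

(** * The multiplicative group of positive reals *)

Section PositiveGroup.
Context {R : realType}.
Implicit Types s t : positive_reals R.

Definition pos_one : positive_reals R := mkpos ltr01.

Fact val_pos_inv_gt0 t : 0 < (\val t)^-1.
Proof. by rewrite invr_gt0 pos_gt0. Qed.

Definition pos_inv t : positive_reals R := mkpos (val_pos_inv_gt0 t).

Lemma pos_mul1 t : pos_mul pos_one t = t.
Proof. by apply: val_inj; rewrite /= mul1r. Qed.

Lemma pos_mulC s t : pos_mul s t = pos_mul t s.
Proof. by apply: val_inj; rewrite /= mulrC. Qed.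

Lemma pos_mulK s t : pos_mul (pos_inv s) (pos_mul s t) = t.
Proof. by apply: val_inj; rewrite /= mulKf// gt_eqF// pos_gt0. Qed.

Lemma pos_mulVK s t : pos_mul s (pos_mul (pos_inv s) t) = t.
Proof. by apply: val_inj; rewrite /= mulVKf// gt_eqF// pos_gt0. Qed.

Lemma pos_mulCA s t u : pos_mul s (pos_mul t u) = pos_mul t (pos_mul s u).
Proof. by apply: val_inj; rewrite /= mulrCA. Qed.

Lemma pos_mul_continuous s : continuous (pos_mul s).
Proof.
move=> t.
have -> : pos_mul s = @to_pos R \o (fun x => \val s * x) \o \val.
  by apply/funext => u; apply: val_inj; rewrite /= val_to_pos// mulr_gt0// pos_gt0.
apply: continuous_comp; first exact: val_pos_continuous.
apply: continuous_comp; first exact: mulrl_continuous.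
by apply: to_pos_continuous; rewrite mulr_gt0// pos_gt0.
Qed.

End PositiveGroup.

Lemma metric0l {R : realType} {E : normedModType R} (M : riemannian_manifold E)
  (p : M) (v : E) : metric p 0 v = 0.
Proof.
by have := metric_linear p (-1) 0 0 v; rewrite scaler0 addr0 mulN1r addNr.
Qed.

(** * Product maps of the cone and their pullback metrics *)

Section ConeMaps.
Context {R : realType} {E : normedModType R}.
Context {W : riemannian_manifold E}.
Implicit Types (psi : W -> W) (rho : positive_reals R) (f : cone W -> cone W).

Definition cone_map rho psi (p : cone W) : cone W := (psi p.1, pos_mul rho p.2).

Definition cone_slice f (w : W) : W := (f (w, pos_one)).1.

Lemma cone_map_id psi : cone_map pos_one psi = prod_id psi.
Proof. by apply/funext => -[w t]; rewrite /cone_map pos_mul1. Qed.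

Lemma cone_map_slice rho psi : cone_slice (cone_map rho psi) = psi.
Proof. by []. Qed.

Lemma cone_map_commutes rho psi : commutes_with_radial_flow (cone_map rho psi).
Proof. by move=> s [w t]; rewrite /cone_map /radial_flow /= pos_mulCA. Qed.

Lemma smooth_cone_map rho psi : smooth psi -> smooth (cone_map rho psi).
Proof.
move=> [psic psis].
have fc : continuous (cone_map rho psi).
  move=> p.
  have h1 : {for p, continuous (psi \o fst)}.
    exact: (@continuous_comp _ _ _ fst _ p cvg_fst (psic p.1)).
  have h2 : {for p, continuous (pos_mul rho \o snd)}.
    exact: (@continuous_comp _ _ _ snd _ p cvg_snd (pos_mul_continuous rho p.2)).
  exact: (cvg_pair h1 h2).
split => // _ _ [c ac <-] [d ad <-] k.
have oU := chart_preimage_open (cone_map rho psi) (cone_chart c) (cone_chart d) fc.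
apply: (Ck_on_congr (f := fun x : E * R => ((d \o psi \o param c) x.1, \val rho * x.2)) oU).
  by case=> y s [[/= _ s0] _]; rewrite val_to_pos.
apply: Ck_on_pair => //.
  have h := Ck_on_compl (l := fst : {linear (E * R)%type -> E})
    (chart_preimage_open psi c d psic) (@fst_continuous E R) (psis _ _ ac ad k).
  by apply: Ck_on_sub _ h => -[y s] [[/= ty s0] [/= sy _]].
apply: Ck_on_mul => //; first exact: Ck_on_cst.
exact: Ck_on_linear (@snd_continuous E R).
Qed.

(** In product charts this is the coordinate expression of [f], projected to [E] and restricted to
    the slice at height 1. *)
Lemma smooth_cone_slice f : smooth f -> smooth (cone_slice f).
Proof.
move=> [fc fs].
have sc : continuous (cone_slice f).
  move=> w.
  have h1 : {for w, continuous (fun w : W => (w, pos_one) : cone W)}.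
    exact: (cvg_pair (@cvg_id _ (nbhs w)) (@cvg_cst _ pos_one _ (nbhs w) _)).
  have h2 := continuous_comp h1 (fc (w, pos_one)).
  exact: (@continuous_comp _ _ _ _ fst w h2 cvg_fst).
split => // c d ac ad k.
have ac' : atlas (cone_chart c : chart _ (cone W)) by exists c.
have ad' : atlas (cone_chart d : chart _ (cone W)) by exists d.
have oV := chart_preimage_open f (cone_chart c) (cone_chart d) fc.
have h := Ck_on_slice (1 : R) oV (Ck_on_linear_comp (fst : {linear (E * R)%type -> E})
  oV (@fst_continuous E R) (fs _ _ ac' ad' k)).
have e1 : to_pos 1 = pos_one :> positive_reals R.
  by apply: val_inj; rewrite val_to_pos.
apply: (Ck_on_congr (chart_preimage_open _ c d sc)); last first.
  apply: Ck_on_sub _ h => x [tx sx]; split; first by split => //=; exact: ltr01.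
  by split => //=; rewrite e1.
by move=> x [tx sx] /=; rewrite e1.
Qed.

Lemma tangent_cone_map rho psi p u a : smooth psi ->
  tangent_map (cone_map rho psi) p (u, a) = (tangent_map psi p.1 u, \val rho * a).
Proof.
case: p => w t psis; rewrite /tangent_map /=.
set c := chart_at w; set d := chart_at (psi w).
have dx : differentiable (d \o psi \o param c) (c w) by exact: tangent_map_differentiable.
pose x : E * R := (c w, \val t).
have tx : target (cone_chart c) x.
  by split; [apply: chart_map_target; exact: chart_at_source|exact: pos_gt0].
pose T (y : E * R) : E * R := ((d \o psi \o param c \o fst) y, (\val rho *: snd y : R)).
have dfst : differentiable (fst : E * R -> E) x.
  exact: linear_differentiable (@fst_continuous E R).
have dsnd : differentiable (snd : E * R -> R) x.
  exact: linear_differentiable (@snd_continuous E R).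
have dT1 : differentiable ((d \o psi \o param c) \o fst) x.
  exact: differentiable_comp.
have dT2 : differentiable (\val rho \*: (snd : E * R -> R)) x by exact: differentiableZ.
have dT : differentiable T x by exact: differentiable_pair.
(* The two maps agree only at positive heights, because [to_pos] has a junk value elsewhere;
   agreement near [x] suffices for the derivative. *)
have nT : {near x, T =1 cone_chart d \o cone_map rho psi \o param (cone_chart c)}.
  apply: filterS (open_nbhs_nbhs (conj (target_open (cone_chart c)) tx)).
  by case=> y s [/= _ s0]; rewrite /T/= val_to_pos.
rewrite -deriveE; last exact: near_eq_differentiable nT dT.
rewrite -(near_eq_derive _ nT) deriveE// diff_pair//.
have esnd : 'd (snd : E * R -> R) x = snd :> (_ -> _).
  exact: (@diff_lin R (E * R)%type R snd x (@snd_continuous E R)).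
have efst : 'd (fst : E * R -> E) x = fst :> (_ -> _).
  exact: (@diff_lin R (E * R)%type E fst x (@fst_continuous E R)).
by rewrite diff_comp//= efst (diffZ _ dsnd) /= esnd.
Qed.

(** The inverse [g] of the product is not assumed to be a product; its slice at height 1
    nevertheless inverts [psi]. *)
Lemma diffeomorphism_cone_map rho psi :
  diffeomorphism (cone_map rho psi) <-> diffeomorphism psi.
Proof.
split=> [[fs [g [gs fgK gfK]]]|[psis [phi [phis psiK phiK]]]].
  split; first exact: (smooth_cone_slice _ fs).
  exists (cone_slice g); split; first exact: smooth_cone_slice.
    (* The height [rho^-1] is chosen so that the image lies at height 1, where [cone_slice g]
       evaluates [g]. *)
    move=> w; have := fgK (w, pos_mul (pos_inv rho) pos_one).
    by rewrite /cone_map /= pos_mulVK /cone_slice => ->.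
  by move=> w; have [] := gfK (w, pos_one).
split; first exact: smooth_cone_map.
exists (cone_map (pos_inv rho) phi); split; first exact: smooth_cone_map.
- by move=> [w t]; rewrite /cone_map /= psiK pos_mulK.
- by move=> [w t]; rewrite /cone_map /= phiK pos_mulVK.
Qed.

(** The factor rho^2 has two sources: the differential in the radial term, and the new height
    [rho * t] in the horizontal term. *)
Lemma pullback_cone_map rho psi p u v : smooth psi ->
  pullback_metric (cone_map rho psi) p u v =
  (\val rho) ^+ 2 * (u.2 * v.2 + (\val p.2) ^+ 2 * pullback_metric psi p.1 u.1 v.1).
Proof.
case: u v => [u a] [v b] psis; rewrite /pullback_metric !tangent_cone_map//=.
by rewrite /cone_metric/= mulrACA -expr2 exprMn mulrDr !mulrA.
Qed.

Lemma homothety_cone_map rho psi :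
  homothety rho (cone_map rho psi) <-> riemannian_isometry psi.
Proof.
rewrite /homothety /riemannian_isometry diffeomorphism_cone_map.
split=> -[dpsi h]; have [psis _] := dpsi; split => // p u v.
  (* On horizontal vectors at height 1 the cone metric is the metric of [W], and rho^2 cancels. *)
  have := h (p, pos_one) (u, 0) (v, 0); rewrite pullback_cone_map//= /cone_metric/=.
  rewrite mulr0 !add0r expr1n !mul1r; apply: mulfI.
  by rewrite expf_neq0// gt_eqF// pos_gt0.
by rewrite pullback_cone_map// h.
Qed.

Lemma homothety1 f : homothety pos_one f <-> riemannian_isometry f.
Proof.
by split=> -[df h]; split => // p u v; have := h p u v; rewrite expr1n mul1r.
Qed.

(* [f] sends the ray [s |-> (w, s)] to [s |-> (psi w, s * b)], so
   [df] maps the unit vector [d/dt] at [(w, 1)] to [(0, b)], of squared norm [b ^ 2]. *)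
Lemma homothety_commutes_cone_map rho f :
  homothety rho f -> commutes_with_radial_flow f -> f = cone_map rho (cone_slice f).
Proof.
move=> [[fs _] h] fcom.
(* The point [(w, t)] is the image of [(w, 1)] under the flow at time [t]. *)
have fE w t : f (w, t) = (cone_slice f w, pos_mul t (f (w, pos_one)).2).
  have := fcom t (w, pos_one).
  by rewrite {1}/radial_flow/= pos_mulC pos_mul1 => ->.
suff bE w : (f (w, pos_one)).2 = rho.
  by apply/funext => -[w t]; rewrite fE bE pos_mulC.
set b := (f (w, pos_one)).2.
have TE : tangent_map f (w, pos_one) (0, 1) = (0, \val b).
  have df := tangent_map_differentiable f (w, pos_one) fs.
  rewrite /tangent_map -deriveE//; apply: cvg_lim => //.
  (* In the charts [f] is affine along the ray, so the difference quotient equals [(0, b)] for all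
     small nonzero [e]; [e > -1] keeps the height positive. *)
  apply: cvg_near_cst.
  near=> e.
  have e1_gt0 : 0 < e + 1.
    by rewrite -ltrBlDr sub0r; near: e; apply: nbhs_dnbhs; apply: lt_nbhsr; exact: ltrN10.
  have e_neq0 : e != 0 by near: e; exact: nbhs_dnbhs_neq.
  have pos1 : to_pos 1 = pos_one :> positive_reals R.
    by apply: val_inj; rewrite val_to_pos.
  rewrite /= scaler0 add0r chart_mapK; last exact: chart_at_source.
  rewrite pos1 (fE w (to_pos _)) -/b /= val_to_pos [e%:A]mulr1//.
  have -> : (f (w, pos_one)).1 = cone_slice f w by [].
  congr pair => /=; first by rewrite subrr scaler0.
  by rewrite mulrDl mul1r addrK [LHS]mulKf.
have := h (w, pos_one) (0, 1) (0, 1).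
rewrite /pullback_metric TE /= /cone_metric/= !metric0l !mulr0 !addr0 !mulr1 -expr2.
(* What remains is b^2 = rho^2 between positive numbers. *)
move=> /eqP; rewrite eqrXn2 ?ltW ?pos_gt0// => /eqP /val_inj.
Unshelve. all: by end_near. Qed.

End ConeMaps.

Theorem proposition4p1 (R : realType) (n : nat)
    (W : riemannian_manifold 'rV[R]_n) :
  (forall (rho : positive_reals R) (f : cone W -> cone W),
    homothety rho f -> commutes_with_radial_flow f ->
    exists psi : W -> W, riemannian_isometry psi /\
      forall (w : W) (t : positive_reals R), f (w, t) = (psi w, pos_mul rho t)) /\
  set_bij [set psi : W -> W | riemannian_isometry psi]
    [set f : cone W -> cone W | riemannian_isometry f /\ commutes_with_radial_flow f]
    (@prod_id R 'rV[R]_n W).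
Proof.
split=> [rho f hf fcom|].
  have fE := homothety_commutes_cone_map _ _ hf fcom.
  exists (cone_slice f); split; last by move=> w t; rewrite {1}fE.
  by move: hf; rewrite {1}fE => /homothety_cone_map.
split.
- move=> psi /= psii; rewrite -cone_map_id; split; last exact: cone_map_commutes.
  by apply/homothety1/homothety_cone_map.
(* Injectivity: [cone_slice] recovers [psi] from [prod_id psi]. *)
- by move=> psi phi _ _ e; rewrite -(cone_map_slice pos_one psi) cone_map_id e -cone_map_id.
- move=> f /= [/homothety1 hf fcom].
  have fE := homothety_commutes_cone_map _ _ hf fcom.
  exists (cone_slice f) => /=; last by rewrite -cone_map_id.
  by move: hf; rewrite {1}fE => /homothety_cone_map.
Qed.
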